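(* Fix an equation $(f,q,w)$ as in the context. For $a_{12},b_{21}\in\mathbb R$ and a fixed $z\in\mathbb C$ let $\mathbf A(a_{12},b_{21})$ be the self-adjoint boundary condition with coefficient matrix $\begin{pmatrix}1&a_{12}&\bar z&0\\0&z&b_{21}&1\end{pmatrix}$, and let $\mathbf S_1=\begin{pmatrix}0&1&0&0\\0&0&b_{21}&1\end{pmatrix}$, $\mathbf S_2=\begin{pmatrix}1&a_{12}&0&0\\0&0&1&0\end{pmatrix}$. Then the problem with $\mathbf A(a_{12},b_{21})$ has exactly $N$ eigenvalues if $a_{12}\ne1/f_0$ and exactly $N-1$ if $a_{12}=1/f_0$; with $\mathbf S_1$ it has exactly $N$ eigenvalues; with $\mathbf S_2$ it has exactly $N-1$ eigenvalues if $a_{12}\neq1/f_0$ and exactly $N-2$ if $a_{12}=1/f_0$. Further: (i) fix $b_{21}$ and let $a^{(1)}<a^{(2)}\le1/f_0<a^{(3)}<a^{(4)}$; writing $\lambda_n(a^{(i)})$ for the eigenvalues with $\mathbf A(a^{(i)},b_{21})$ and $\lambda_n(\mathbf S_1)$ for those with $\mathbf S_1$: for each $0\le n\le N-2$, $\lambda_n(a^{(3)})\le\lambda_n(a^{(4)})\le\lambda_n(\mathbf S_1)\le\lambda_n(a^{(1)})\le\lambda_n(a^{(2)})\le\lambda_{n+1}(a^{(3)})$, and $\lambda_{N-1}(a^{(3)})\le\lambda_{N-1}(a^{(4)})\le\lambda_{N-1}(\mathbf S_1)\le\lambda_{N-1}(a^{(1)})$; in addition $\lambda_{N-1}(a^{(1)})\le\lambda_{N-1}(a^{(2)})$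 if $a^{(2)}<1/f_0$; (ii) fix $a_{12}$ and let $b^{(1)}<b^{(2)}$; writing $\lambda_n(b^{(j)})$ for the eigenvalues with $\mathbf A(a_{12},b^{(j)})$ and $\lambda_n(\mathbf S_2)$ for those with $\mathbf S_2$: for each $0\le n\le N-3$, $\lambda_n(b^{(1)})\le\lambda_n(b^{(2)})\le\lambda_n(\mathbf S_2)\le\lambda_{n+1}(b^{(1)})$, and $\lambda_{N-2}(b^{(1)})\le\lambda_{N-2}(b^{(2)})$; in addition, if $a_{12}\neq1/f_0$, then $\lambda_{N-2}(b^{(2)})\le\lambda_{N-2}(\mathbf S_2)\le\lambda_{N-1}(b^{(1)})\le\lambda_{N-1}(b^{(2)})$.
   Context: Let $N\ge2$ be an integer. An equation is given by real sequences $f=\{f_n\}_{n=0}^N$, $q=\{q_n\}_{n=1}^N$, $w=\{w_n\}_{n=1}^N$ with $f_n\neq0$, $w_n>0$; it is $-\nabla(f_n\Delta y_n)+q_ny_n=\lambda w_ny_n$, $1\le n\le N$, for $y=\{y_n\}_{n=0}^{N+1}$, $\Delta y_n=y_{n+1}-y_n$, $\nabla y_n=y_n-y_{n-1}$. A boundary condition with $2\times4$ coefficient matrix $(A,B)$ (rank 2) is $A(y_0,f_0\Delta y_0)^T+B(y_N,f_N\Delta y_N)^T=0$; matrices differing by left multiplication by an invertible $2\times2$ complex matrix give the same condition. Eigenvalues ($\lambda$ with a nontrivial solution) of a self-adjoint problem are real; multiplicity = dimension of the solution space (equal to the multiplicity as a zero of the characteristic polynomial); counted with multiplicity they are ordered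 $\lambda_0\le\lambda_1\le\cdots$, and ''exactly $k$ eigenvalues'' counts multiplicity. *)

(* Defs.v *)
From HB Require Import structures.
From mathcomp Require Import all_boot all_order all_algebra.
From mathcomp Require Import reals.
From mathcomp Require Export complex.
Set Implicit Arguments. Unset Strict Implicit. Unset Printing Implicit Defensive.
Import Order.TTheory GRing.Theory Num.Theory.
Local Open Scope ring_scope.
Local Open Scope complex_scope.

Section DSL.
Variable R : realType.
Local Notation C := R[i].

(* The equation (f, q, w): f_0..f_N, q_1..q_N, w_1..w_N (values of the
   sequences outside these ranges are irrelevant). A solution is
   y = (y_0, ..., y_{N+1}) stored as a row vector of length N+2. *)
Variables (N : nat) (f q w : nat -> R).

Definition yv (y : 'rV[C]_(N.+2)) (k : nat) : C := y 0 (inord k).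

Definition dlt (y : 'rV[C]_(N.+2)) (k : nat) : C := yv y k.+1 - yv y k.

(* residual of  -nabla(f_n Delta y_n) + q_n y_n - lambda w_n y_n  at n *)
Definition eq_res (lam : C) (y : 'rV[C]_(N.+2)) (n : nat) : C :=
  - ((f n)%:C * dlt y n - (f n.-1)%:C * dlt y n.-1)
  + (q n)%:C * yv y n - lam * (w n)%:C * yv y n.

Definition bvec (y : 'rV[C]_(N.+2)) : 'cV[C]_4 :=
  \col_(j < 4) nth 0 [:: yv y 0; (f 0)%:C * dlt y 0;
                         yv y N; (f N)%:C * dlt y N] j.

(* The full system (N difference equations for 1 <= n <= N, then the two
   rows of the boundary condition (A,B)(bvec y) = 0), as a linear map. *)
Definition res_map (AB : 'M[C]_(2,4)) (lam : C) (y : 'rV[C]_(N.+2))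
  : 'rV[C]_(N.+2) :=
  \row_(i < N.+2)
    (if (i < N)%N then eq_res lam y i.+1
     else (AB *m bvec y) (inord (i - N)) 0).

Definition sol_space (AB : 'M[C]_(2,4)) (lam : C) :=
  kermx (lin1_mx (res_map AB lam)).

Definition mult (AB : 'M[C]_(2,4)) (lam : C) : nat := \rank (sol_space AB lam).

Definition is_eigenvalue (AB : 'M[C]_(2,4)) (lam : C) : Prop :=
  (0 < mult AB lam)%N.

(* s is the nondecreasing list lambda_0 <= lambda_1 <= ... of all the
   eigenvalues, which are real, each repeated according to multiplicity. *)
Definition eig_list (AB : 'M[C]_(2,4)) (s : seq R) : Prop :=
  sorted <=%R s /\
  forall lam : C, count_mem lam (map (fun x : R => x%:C) s) = mult AB lam.

Definition has_exactly (AB : 'M[C]_(2,4)) (k : nat) : Prop :=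
  exists s, eig_list AB s /\ size s = k.

End DSL.

Definition bcA (R : realType) (z : R[i]) (a12 b21 : R) : 'M[R[i]]_(2,4) :=
  \matrix_(i < 2, j < 4)
    nth 0 (nth [::] [:: [:: 1; a12%:C; z^*; 0]; [:: 0; z; b21%:C; 1]] i) j.

Definition bcS1 (R : realType) (b21 : R) : 'M[R[i]]_(2,4) :=
  \matrix_(i < 2, j < 4)
    nth 0 (nth [::] [:: [:: 0; 1; 0; 0]; [:: 0; 0; b21%:C; 1]] i) j.

Definition bcS2 (R : realType) (a12 : R) : 'M[R[i]]_(2,4) :=
  \matrix_(i < 2, j < 4)
    nth 0 (nth [::] [:: [:: 1; a12%:C; 0; 0]; [:: 0; 0; 1; 0]] i) j.

(* Main.v *)
Require Import Defs.
From HB Require Import structures.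
From mathcomp Require Import all_boot all_order all_algebra.
From mathcomp Require Import reals complex ring zify.
Set Implicit Arguments. Unset Strict Implicit. Unset Printing Implicit Defensive.
Import Order.TTheory GRing.Theory Num.Theory.
Local Open Scope ring_scope.
Local Open Scope complex_scope.
Local Open Scope sesquilinear_scope.

(** Eliminating y_0 and y_(N+1), a problem with boundary condition A, S1 or S2
    becomes a Hermitian eigenvalue problem for x = (y_1, ..., y_N), relative to
    the weight w, for the form
      J(x) + alpha |x_1 + conj(z) x_N|^2 + beta |x_N|^2.
    Here J does not depend on the boundary condition, and a coefficient +oo
    means that the corresponding elementary form is constrained to vanish. With
    the convention 1 / 0 = +oo, the coefficients (alpha, beta) are
      A  : (1 / (1 / f_0 - a_12), b_21),
      S1 : (0, b_21),
      S2 : (1 / (1 / f_0 - a_12), +oo).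
    The number of eigenvalues is N minus the number of infinite coefficients.
    By the Courant-Fischer principle, raising the coefficients raises every
    eigenvalue, and each coefficient that is lowered shifts the index in this
    comparison by one. *)

Local Notation "B ^!" :=
  (orthomx Num.conj (mx_of_hermitian (hermitian1mx _)) B) : matrix_set_scope.
Local Notation "A '_|_ B" := (A%MS <= B^!)%MS : bool_scope.
Local Notation "d %:diagC" := (diag_mx (map_mx (real_complex _) d))
  (at level 2, left associativity, format "d %:diagC").

(** * Hermitian pencils on a subspace *)

Section HermitianForms.
Variable C : numClosedFieldType.

Lemma trmxC_mul m n p (A : 'M[C]_(m, n)) (B : 'M[C]_(n, p)) :
  (A *m B)^t* = B^t* *m A^t*.
Proof. by rewrite trmx_mul map_mxM. Qed.

Lemma mulmx_congr_comp m n p (A : 'M[C]_(m, n)) (B : 'M[C]_(n, p)) M :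
  A *m B *m M *m (A *m B)^t* = A *m (B *m M *m B^t*) *m A^t*.
Proof. by rewrite trmxC_mul !mulmxA. Qed.

Lemma hermsymmxP n (A : 'M[C]_n) : reflect (A^t* = A) (A \is hermsymmx).
Proof.
by apply: (iffP (is_hermitianmxP _ _ _)); rewrite expr0 scale1r => /esym.
Qed.

Lemma hermsymmx_congr m n (A : 'M[C]_(m, n)) (M : 'M[C]_n) :
  M \is hermsymmx -> A *m M *m A^t* \is hermsymmx.
Proof.
by move=> /hermsymmxP ME; apply/hermsymmxP; rewrite !trmxC_mul trmxCK ME mulmxA.
Qed.

Lemma hermsymmxD n (A B : 'M[C]_n) :
  A \is hermsymmx -> B \is hermsymmx -> A + B \is hermsymmx.
Proof.
move=> /hermsymmxP AE /hermsymmxP BE; apply/hermsymmxP.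
by rewrite linearD map_mxD AE BE.
Qed.

Lemma hermsymmx_diag n (d : 'rV[C]_n) :
  (forall i, d 0 i \is Num.real) -> diag_mx d \is hermsymmx.
Proof.
move=> d_real; apply/hermsymmxP; rewrite tr_diag_mx map_diag_mx.
by congr diag_mx; apply/rowP => i; rewrite mxE; apply/CrealP.
Qed.

Definition qform n (M : 'M[C]_n) (x : 'rV[C]_n) : C := (x *m M *m x^t*) 0 0.

Lemma qformD n (A B : 'M[C]_n) x : qform (A + B) x = qform A x + qform B x.
Proof. by rewrite /qform mulmxDr mulmxDl mxE. Qed.

Lemma qform_diag n (d x : 'rV[C]_n) :
  qform (diag_mx d) x = \sum_i d 0 i * (x 0 i * (x 0 i)^*).
Proof.
rewrite /qform mul_mx_diag mxE; apply: eq_bigr => i _; rewrite !mxE.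
by rewrite mulrCA mulrA.
Qed.

Lemma qform_congr m n (A : 'M[C]_(m, n)) (M : 'M[C]_n) x :
  qform (A *m M *m A^t*) x = qform M (x *m A).
Proof. by rewrite /qform trmxC_mul !mulmxA. Qed.

Definition posdefmx n (M : 'M[C]_n) : Prop :=
  M \is hermsymmx /\ forall x, x != 0 -> 0 < qform M x.

Lemma posdefmx_congr m n (A : 'M[C]_(m, n)) (M : 'M[C]_n) :
  row_free A -> posdefmx M -> posdefmx (A *m M *m A^t*).
Proof.
move=> Afree [Mherm Mpos]; split=> [|x x0]; first exact: hermsymmx_congr.
by rewrite qform_congr Mpos// mulmx_free_eq0.
Qed.

Lemma posdefmx_diag n (d : 'rV[C]_n) :
  (forall i, 0 < d 0 i) -> posdefmx (diag_mx d).
Proof.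
move=> d_gt0; split=> [|x /rV0Pn[j xj]].
  by apply: hermsymmx_diag => i; apply: gtr0_real.
rewrite qform_diag (bigD1 j)//=; apply: ltr_pwDl.
  by rewrite mulr_gt0 ?mul_conjC_gt0.
by apply: sumr_ge0 => i _; rewrite mulr_ge0 ?mul_conjC_ge0// ltW.
Qed.

Lemma hermsymmx_unitary_diag n (A : 'M[C]_n) : A \is hermsymmx ->
  spectralmx A *m A *m (spectralmx A)^t* = diag_mx (spectral_diag A).
Proof.
move=> /hermitian_normalmx /orthomx_spectralP AE.
have Uunit := spectral_unit A.
rewrite {2}AE -invmx_unitary ?spectral_unitarymx//.
by rewrite !mulmxA mulmxV// mul1mx mulmxK.
Qed.

Lemma posdefmx_congr1 n (M : 'M[C]_n) : posdefmx M ->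
  exists2 S : 'M[C]_n, S \in unitmx & S *m M *m S^t* = 1%:M.
Proof.
move=> [Mherm Mpos].
pose U := spectralmx M; pose d := spectral_diag M.
have d_gt0 i : 0 < d 0 i.
  have := Mpos ('e_i *m U); rewrite -qform_congr hermsymmx_unitary_diag//.
  rewrite mulmx_free_eq0 ?row_free_unit ?spectral_unit// qform_diag.
  rewrite (bigD1 i)//= big1 => [|j ji]; last first.
    by rewrite !mxE (negPf ji) mul0r mulr0.
  rewrite !mxE !eqxx conjC1 !mulr1 addr0; apply.
  by apply/rV0Pn; exists i; rewrite mxE !eqxx oner_eq0.
pose s := \row_i (sqrtC (d 0 i))^-1.
have sC : (diag_mx s)^t* = diag_mx s.
  apply/hermsymmxP/hermsymmx_diag => i.
  by rewrite mxE gtr0_real// invr_gt0 sqrtC_gt0.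
have s_neq0 i : sqrtC (d 0 i) != 0 by rewrite sqrtC_eq0 gt_eqF.
exists (diag_mx s *m U).
  rewrite unitmx_mul spectral_unit andbT unitmxE det_diag unitfE.
  by apply/prodf_neq0 => i _; rewrite mxE invr_eq0.
rewrite mulmx_congr_comp hermsymmx_unitary_diag// sC !mulmx_diag.
rewrite -diag_const_mx; congr diag_mx; apply/rowP => i.
rewrite !mxE -/d -[X in _ * X / _]sqrtCK expr2.
by rewrite mulKf// mulfV.
Qed.

End HermitianForms.

Section SelectedRows.
Variables (F : fieldType) (m n : nat) (S : {pred 'I_m}) (A : 'M[F]_(m, n)).

Definition rows_in : 'M[F]_(#|S|, n) := rowsub (@enum_val _ S) A.

Lemma sub_rows_inP (x : 'rV[F]_n) :
  reflect (exists2 a : 'rV_m, forall i, i \notin S -> a 0 i = 0 & x = a *m A)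
          (x <= rows_in)%MS.
Proof.
apply: (iffP submxP) => [[b ->]|[a a0 ->]].
  exists (b *m rowsub (@enum_val _ S) 1%:M) => [i iS|]; last first.
    by rewrite -mulmxA mul_rowsub_mx mul1mx.
  rewrite mxE big1// => j _; rewrite !mxE; case: eqP => [ji|_].
    by rewrite -ji enum_valP in iS.
  exact: mulr0.
apply/submxP; rewrite mulmx_sum_row; apply: summx_sub => i _.
have [iS|/a0->] := boolP (i \in S); last by rewrite scale0r sub0mx.
apply: scalemx_sub; have := row_sub (enum_rank_in iS i) rows_in.
by rewrite row_rowsub enum_rankK_in.
Qed.

Lemma rows_in_sub : (rows_in <= A)%MS.
Proof. by apply/row_subP => i; rewrite row_rowsub row_sub. Qed.

Lemma mxrank_rows_in : row_free A -> \rank rows_in = #|S|.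
Proof.
move=> Afree; apply/eqP/inj_row_free => v.
set sel : 'M[F]_(#|S|, m) := rowsub (@enum_val _ S) 1%:M.
have -> : rows_in = sel *m A by rewrite mul_rowsub_mx mul1mx.
rewrite mulmxA => /eqP; rewrite mulmx_free_eq0// => /eqP/rowP v0.
apply/rowP => j; have := v0 (enum_val j); rewrite !mxE => <-.
rewrite (bigD1 j)//= big1 => [|i ij]; first by rewrite !mxE eqxx mulr1 addr0.
by rewrite !mxE (inj_eq enum_val_inj) (negPf ij) mulr0.
Qed.

End SelectedRows.

Lemma orthomx_rows_inP (C : numClosedFieldType) m n (S : {pred 'I_m})
    (A : 'M[C]_(m, n)) (x : 'rV[C]_n) :
  reflect (forall i, i \in S -> (x *m A^t*) 0 i = 0) (x '_|_ rows_in S A)%MS.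
Proof.
have -> : (x '_|_ rows_in S A)%MS =
    (colsub (@enum_val _ S) (x *m A^t*) == 0).
  rewrite orthomx1E -mulmx_colsub; congr (_ *m _ == 0).
  by apply/matrixP => i j; rewrite !mxE.
apply: (iffP eqP) => [/rowP x0 i iS|x0].
  by have := x0 (enum_rank_in iS i); rewrite !mxE enum_rankK_in.
by apply/rowP => j; rewrite mxE x0 ?enum_valP// mxE.
Qed.

Lemma eqmx_ortho (C : numClosedFieldType) m1 m2 n (A : 'M[C]_(m1, n))
    (B : 'M[C]_(m2, n)) : (A :=: B)%MS -> (A^! :=: B^!)%MS.
Proof. by move=> AB; apply/eqmxP; rewrite !submx_ortho !AB submx_refl. Qed.

Lemma leq_mxrank_cap (F : fieldType) m1 m2 m3 n (A : 'M[F]_(m1, n))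
    (B : 'M[F]_(m2, n)) (V : 'M[F]_(m3, n)) :
  (A <= V)%MS -> (B <= V)%MS ->
  (\rank A + \rank B <= \rank V + \rank (A :&: B))%N.
Proof.
move=> AV BV; rewrite -mxrank_sum_cap leq_add2r; apply: mxrankS.
by rewrite addsmx_sub AV.
Qed.

Lemma ord2P (k : 'I_2) : k = ord0 \/ k = ord_max.
Proof.
by case: k => -[|[|//]] k2; [left | right]; apply: val_inj.
Qed.

Lemma card_ord2 (p : pred 'I_2) : #|[pred k | p k]| = (p ord0 + p ord_max)%N.
Proof.
rewrite -sum1_card big_mkcond !big_ord_recl big_ord0 !inE.
rewrite (_ : lift ord0 ord0 = ord_max); last exact: val_inj.
by case: (p ord0); case: (p ord_max).
Qed.

Lemma ltn_count_le_nth disp (T : orderType disp) (x0 : T) (s : seq T) j :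
  sorted <=%O s -> (j < size s)%N -> (j < count (<= nth x0 s j)%O s)%N.
Proof.
move=> s_sorted js; rewrite ltnNge; apply/negP => cj.
by have := nth_count_gt x0 s_sorted (introT andP (conj cj js)); rewrite ltxx.
Qed.

Section Spectrum.
Variables (R : realDomainType) (k : nat) (d : 'rV[R]_k).

Definition spectrum : seq R := sort <=%R [seq d 0 i | i : 'I_k].

Lemma size_spectrum : size spectrum = k.
Proof. by rewrite size_sort size_map size_enum_ord. Qed.

Lemma sorted_spectrum : sorted <=%R spectrum.
Proof. exact: sort_le_sorted. Qed.

Lemma count_spectrum (p : pred R) : count p spectrum = #|[pred i | p (d 0 i)]|.
Proof.
by rewrite count_sort count_map -sum1_count -sum1_card big_enum_cond.
Qed.

End Spectrum.

Section Diagonalization.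
Variable R : rcfType.
Local Notation C := R[i].

Definition diagonalizes k n (W H : 'M[C]_n) (P : 'M[C]_(k, n)) (d : 'rV[R]_k) :
    Prop :=
  P *m W *m P^t* = 1%:M /\ P *m H *m P^t* = d%:diagC.

Lemma exists_diagonalizes m n (W H : 'M[C]_n) (V : 'M[C]_(m, n)) :
  posdefmx W -> H \is hermsymmx ->
  exists (P : 'M_(\rank V, n)) d, diagonalizes W H P d /\ (P :=: V)%MS.
Proof.
move=> Wpos Hherm; pose B := row_base V.
have [S Sunit SB1] := posdefmx_congr1 (posdefmx_congr (row_base_free V) Wpos).
pose A := S *m B *m H *m (S *m B)^t*; pose U := spectralmx A.
have Aherm : A \is hermsymmx by exact: hermsymmx_congr.
have UU : U *m U^t* = 1%:M by apply/unitarymxP/spectral_unitarymx.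
exists (U *m (S *m B)), (map_mx (@complex.Re R) (spectral_diag A)).
split; [split|].
- rewrite mulmx_congr_comp (_ : S *m B *m W *m _ = 1%:M) ?mulmx1//.
  by rewrite -SB1 trmxC_mul !mulmxA.
- have -> : (map_mx (@complex.Re R) (spectral_diag A))%:diagC =
      diag_mx (spectral_diag A).
    congr diag_mx; apply/rowP => i; rewrite !mxE RRe_real//.
    exact: (mxOverP (hermitian_spectral_diag_real Aherm)).
  by rewrite mulmx_congr_comp -hermsymmx_unitary_diag.
- apply: eqmx_trans (eq_row_base V); rewrite mulmxA.
  by apply/eqmxMfull; rewrite row_full_unit unitmx_mul spectral_unit.
Qed.

Section DiagonalizedPencil.
Variables (k n : nat) (W H : 'M[C]_n) (P : 'M[C]_(k, n)) (d : 'rV[R]_k).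
Hypothesis PD : diagonalizes W H P d.

Lemma diagonalizes_free : row_free P.
Proof.
rewrite /row_free eqn_leq rank_leq_row -{1}(mxrank1 C k) -PD.1 -mulmxA.
exact: mxrankM_maxl.
Qed.

Lemma qform_coord_weight (a : 'rV[C]_k) :
  qform W (a *m P) = \sum_i a 0 i * (a 0 i)^*.
Proof.
rewrite -qform_congr PD.1 -diag_const_mx qform_diag.
by apply: eq_bigr => i _; rewrite mxE mul1r.
Qed.

Lemma qform_coord (a : 'rV[C]_k) :
  qform H (a *m P) = \sum_i (d 0 i)%:C * (a 0 i * (a 0 i)^*).
Proof.
by rewrite -qform_congr PD.2 qform_diag; apply: eq_bigr => i _; rewrite mxE.
Qed.

Lemma qform_le_sublevel (mu : R) x :
  (x <= rows_in [pred i | (d 0 i <= mu)%R] P)%MS ->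
  qform H x <= mu%:C * qform W x.
Proof.
move=> /sub_rows_inP[a a0 ->]; rewrite qform_coord qform_coord_weight mulr_sumr.
apply: ler_sum => i _; have [di|/a0->] := boolP (i \in [pred i | d 0 i <= mu]).
  by rewrite ler_wpM2r ?mul_conjC_ge0// lecR.
by rewrite mul0r !mulr0.
Qed.

Lemma qform_gt_superlevel (mu : R) x :
  (x <= rows_in [pred i | (mu < d 0 i)%R] P)%MS -> x != 0 ->
  mu%:C * qform W x < qform H x.
Proof.
move=> /sub_rows_inP[a a0 ->] aP_neq0.
have /rV0Pn[j aj] : a != 0 by apply: contraNneq aP_neq0 => ->; rewrite mul0mx.
rewrite qform_coord qform_coord_weight mulr_sumr -subr_gt0 -sumrB.
have gap i : a 0 i != 0 -> 0 < (d 0 i)%:C - mu%:C :> C.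
  by rewrite subr_gt0 ltcR; apply: contraNT => di; apply/eqP/a0.
rewrite (bigD1 j)//=; apply: ltr_pwDl.
  by rewrite -mulrBl mulr_gt0 ?gap// mul_conjC_gt0.
apply: sumr_ge0 => i _; rewrite -mulrBl.
have [->|ai] := eqVneq (a 0 i) 0; first by rewrite mul0r mulr0.
by rewrite mulr_ge0 ?mul_conjC_ge0// ltW// gap.
Qed.

(* Otherwise U would meet the span of the rows with d_i > mu. *)
Lemma mxrank_le_sublevel m (U : 'M[C]_(m, n)) (mu : R) :
  (U <= P)%MS ->
  (forall x : 'rV_n, (x <= U)%MS -> qform H x <= mu%:C * qform W x) ->
  (\rank U <= #|[pred i | (d 0 i <= mu)%R]|)%N.
Proof.
move=> UP Ule; pose above : {pred 'I_k} := [pred i | mu < d 0 i].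
have := leq_mxrank_cap UP (rows_in_sub above P).
have /eqP-> : (U :&: rows_in above P)%MS == 0.
  apply: contraT => /rowV0Pn[x]; rewrite sub_capmx => /andP[/Ule xU xP] x0.
  by have := lt_le_trans (qform_gt_superlevel xP x0) xU; rewrite ltxx.
have /eqP-> : \rank P == k by exact: diagonalizes_free.
rewrite mxrank_rows_in ?diagonalizes_free// mxrank0 addn0 => rank_le.
have -> : #|[pred i | (d 0 i <= mu)%R]| = #|[predC above]|.
  by apply: eq_card => i; rewrite !inE -leNgt.
by rewrite -(leq_add2l #|above|) cardC card_ord addnC.
Qed.

Lemma sub_eigenrows (lam : C) (x : 'rV_n) :
  (x <= rows_in [pred i | (d 0 i)%:C == lam] P)%MS <->
  (x <= P)%MS /\ (x *m (H - lam *: W) '_|_ P)%MS.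
Proof.
have residual (a : 'rV_k) : a *m P *m (H - lam *: W) *m P^t* =
    \row_i (((d 0 i)%:C - lam) * a 0 i).
  rewrite -[a *m P *m _]mulmxA -[a *m _ *m _]mulmxA mulmxBr mulmxBl PD.2.
  rewrite -scalemxAr -scalemxAl PD.1 scalemx1 mulmxBr mul_mx_diag mul_mx_scalar.
  by apply/rowP=> i; rewrite !mxE; ring.
split=> [/sub_rows_inP[a a0 ->]|[/submxP[a ->] /orthomx1P/rowP eq0]].
  split; first exact: submxMl.
  apply/orthomx1P; rewrite residual; apply/rowP => i; rewrite !mxE.
  have [/eqP->|/a0->] := boolP (i \in [pred i | (d 0 i)%:C == lam]).
    by rewrite subrr mul0r.
  by rewrite mulr0.
apply/sub_rows_inP; exists a => // i; rewrite inE => /negPf di.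
have /eqP := eq0 i; rewrite residual !mxE mulf_eq0 subr_eq0 di /=.
by move/eqP.
Qed.

End DiagonalizedPencil.

(* Courant-Fischer: on U, the span of the eigenvectors of the second pencil with
   eigenvalue at most mu is a sublevel space of the first one. *)
Lemma spectrum_le k1 k2 m n (W H1 H2 : 'M[C]_n) (P1 : 'M_(k1, n)) d1
    (P2 : 'M_(k2, n)) d2 (U : 'M_(m, n)) i j :
  diagonalizes W H1 P1 d1 -> diagonalizes W H2 P2 d2 ->
  (U <= P1)%MS -> (U <= P2)%MS ->
  (forall x : 'rV_n, (x <= U)%MS -> qform H1 x <= qform H2 x) ->
  (i + (k2 - \rank U) <= j < k2)%N ->
  nth 0 (spectrum d1) i <= nth 0 (spectrum d2) j.
Proof.
move=> D1 D2 UP1 UP2 Ule /andP[ij jk2]; set mu := nth 0 (spectrum d2) j.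
pose below2 : {pred 'I_k2} := [pred i | d2 0 i <= mu].
have below2_gt : (j < #|below2|)%N.
  by rewrite -(count_spectrum d2 (<= mu)) ltn_count_le_nth ?sorted_spectrum
    ?size_spectrum.
have capU := leq_mxrank_cap (rows_in_sub below2 P2) UP2.
have cap_le : (\rank (rows_in below2 P2 :&: U)%MS <=
    #|[pred i | (d1 0 i <= mu)%R]|)%N.
  apply: (mxrank_le_sublevel D1); first exact: submx_trans (capmxSr _ _) UP1.
  move=> x; rewrite sub_capmx => /andP[xP2 /Ule/le_trans]; apply.
  exact: qform_le_sublevel xP2.
apply: nth_count_le; first exact: sorted_spectrum.
rewrite count_spectrum; apply: leq_trans cap_le.
move: capU; rewrite (eqP (diagonalizes_free D2)).
by rewrite mxrank_rows_in ?(diagonalizes_free D2)//; lia.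
Qed.

End Diagonalization.

(** * Forms with penalties *)

Section Penalties.
Variable R : rcfType.
Local Notation C := R[i].
Implicit Types (c : option R) (e t : C).

(* A penalty is the coefficient of an elementary form |e|^2; None stands for
   +oo, which forces e = 0 and leaves the dual variable t free. *)
Definition penalty_rel c e t : Prop :=
  if c is Some c' then t = c'%:C * e else e = 0.

Definition penalty_le c1 c2 : bool :=
  match c1, c2 with
  | _, None => true
  | None, Some _ => false
  | Some x, Some y => x <= y
  end.

Definition inv_penalty (x : R) : option R := if x == 0 then None else Some x^-1.

Lemma penalty_le_refl c : penalty_le c c.
Proof. by case: c => /=. Qed.

Lemma penalty_le_None c : penalty_le c None.
Proof. by case: c. Qed.

Lemma inv_penalty_rel x e t : penalty_rel (inv_penalty x) e t <-> e = x%:C * t.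
Proof.
rewrite /inv_penalty; case: eqP => [->|/eqP x0] /=; first by rewrite mul0r.
have xC : x%:C != 0 :> C by rewrite fmorph_eq0.
by split=> ->; rewrite mulrA -rmorphM ?mulfV ?mulVf// mul1r.
Qed.

Lemma inv_penalty_eqNone x : (inv_penalty x == None) = (x == 0).
Proof. by rewrite /inv_penalty; case: (x == 0). Qed.

Lemma inv_penalty_le0 x : penalty_le (inv_penalty x) (Some 0) = (x < 0).
Proof.
rewrite /inv_penalty; case: eqVneq => [->|x0]; first by rewrite ltxx.
by rewrite /= invr_le0 [RHS]lt_neqAle x0.
Qed.

Lemma inv_penalty_ge0 x : penalty_le (Some 0) (inv_penalty x) = (0 <= x).
Proof.
rewrite /inv_penalty; case: eqVneq => [->|x0]; first by rewrite lexx.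
by rewrite /= invr_ge0.
Qed.

Lemma inv_penalty_le x y :
  y <= x -> (x < 0) || (0 <= y) -> penalty_le (inv_penalty x) (inv_penalty y).
Proof.
move=> yx /orP[x0|]; rewrite /inv_penalty.
  have y0 := le_lt_trans yx x0.
  by rewrite !lt_eqF//= lef_nV2 ?negrE.
rewrite le_eqVlt => /predU1P[<-|y0]; first by rewrite eqxx penalty_le_None.
have x0 := lt_le_trans y0 yx.
by rewrite !gt_eqF//= lef_pV2 ?posrE.
Qed.

End Penalties.

Section PenalizedForms.
Variables (R : rcfType) (m n : nat).
Local Notation C := R[i].
Variables (J W : 'M[C]_n) (L : 'M[C]_(m, n)).
Implicit Type a : 'I_m -> option R.

Definition penalized a : 'M[C]_n :=
  J + L^t* *m (\row_k odflt 0 (a k))%:diagC *m L.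

Definition penalty_domain a : 'M[C]_n :=
  ((rows_in [pred k | a k == None] L)^!)%MS.

Definition penalized_eigenbasis a r (P : 'M[C]_(r, n)) d : Prop :=
  diagonalizes W (penalized a) P d /\ (P :=: penalty_domain a)%MS.

Lemma penalized_herm a : J \is hermsymmx -> penalized a \is hermsymmx.
Proof.
move=> Jherm; apply: hermsymmxD; first exact: Jherm.
rewrite -[X in _ *m X]trmxCK; apply/hermsymmx_congr/hermsymmx_diag => k.
by rewrite mxE complex_real.
Qed.

Lemma qform_penalized a x : qform (penalized a) x = qform J x +
  \sum_k (odflt 0 (a k))%:C * ((x *m L^t*) 0 k * ((x *m L^t*) 0 k)^*).
Proof.
rewrite qformD -[X in _ *m X]trmxCK qform_congr qform_diag.
by congr (_ + _); apply: eq_bigr => k _; rewrite !mxE.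
Qed.

Lemma mxrank_penalty_domain a : row_free L ->
  \rank (penalty_domain a) = (n - #|[pred k | a k == None]|)%N.
Proof. by move=> Lfree; rewrite rank_ortho mxrank_rows_in. Qed.

Lemma sub_penalized_eigenrows a r (P : 'M[C]_(r, n)) d (lam : C) (x : 'rV_n) :
  penalized_eigenbasis a P d ->
  (x <= rows_in [pred i | (d 0 i)%:C == lam] P)%MS <->
  exists2 t : 'rV_m, x *m (J - lam *: W) + t *m L = 0 &
    forall k, penalty_rel (a k) ((x *m L^t*) 0 k) (t 0 k).
Proof.
move=> [PD PV]; pose e := x *m L^t*.
pose dual (t : 'rV_m) : 'rV_m := \row_k ((odflt 0 (a k))%:C * e 0 k - t 0 k).
have dualK t : dual (dual t) = t by apply/rowP => k; rewrite !mxE subKr.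
have residual t : x *m (penalized a - lam *: W) =
    (x *m (J - lam *: W) + t *m L) + dual t *m L.
  rewrite /penalized !mulmxBr !mulmxDr !mulmxA -/e mul_mx_diag addrAC -!addrA.
  congr (_ + (_ + _)); rewrite -mulmxDl; congr (_ *m L).
  by apply/rowP => i; rewrite !mxE; ring.
apply: iff_trans (sub_eigenrows PD lam x) _.
have -> : (x *m (penalized a - lam *: W) '_|_ P)%MS =
    (x *m (penalized a - lam *: W) <= rows_in [pred k | a k == None] L)%MS.
  by rewrite (eqmx_ortho PV) ortho_id.
rewrite PV; split=> [[/orthomx_rows_inP x0 /sub_rows_inP[s s0 sE]]|[t xt tP]].
  exists (dual s) => [|i].
    by apply: (addIr (s *m L)); rewrite add0r -{2}sE (residual (dual s)) dualK.
  rewrite [X in penalty_rel _ _ X]mxE; case ai: (a i) => [c|] /=.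
    by rewrite s0 ?subr0 // inE ai.
  by rewrite x0 // inE ai.
split.
  apply/orthomx_rows_inP => i; rewrite inE => /eqP ai.
  by have := tP i; rewrite ai.
rewrite (residual t) xt add0r; apply/sub_rows_inP; exists (dual t) => // i.
rewrite inE mxE; have := tP i; case: (a i) => //= c -> _.
by rewrite subrr.
Qed.

Lemma penalized_spectrum_le a1 a2 k1 k2 (P1 : 'M_(k1, n)) (P2 : 'M_(k2, n))
    d1 d2 i j :
  row_free L ->
  penalized_eigenbasis a1 P1 d1 -> penalized_eigenbasis a2 P2 d2 ->
  (i + #|[pred k | ~~ penalty_le (a1 k) (a2 k)]| <= j < k2)%N ->
  nth 0 (spectrum d1) i <= nth 0 (spectrum d2) j.
Proof.
move=> Lfree [D1 PV1] [D2 PV2] /andP[ij jk2].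
pose unordered := [pred k | ~~ penalty_le (a1 k) (a2 k)].
pose constrained : {pred 'I_m} := [predU [pred k | a2 k == None] & unordered].
have UP (x : 'rV_n) : (x '_|_ rows_in constrained L)%MS ->
    forall k, k \in constrained -> (x *m L^t*) 0 k = 0.
  by move/orthomx_rows_inP.
apply: (spectrum_le (U := (rows_in constrained L)^!%MS) D1 D2).
- rewrite PV1; apply/rV_subP => x /UP x0; apply/orthomx_rows_inP => k.
  by rewrite inE => /eqP a1k; apply: x0; rewrite !inE a1k; case: (a2 k).
- rewrite PV2; apply/rV_subP => x /UP x0; apply/orthomx_rows_inP => k a2k.
  by apply: x0; rewrite inE a2k.
- move=> x /UP x0.
  rewrite [leLHS]qform_penalized [leRHS]qform_penalized lerD2l.
  apply: ler_sum => k _.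
  have [/x0->|] := boolP (k \in constrained); first by rewrite mul0r !mulr0.
  rewrite !inE negb_or negbK => /andP[a2k a12k].
  apply: ler_wpM2r; first exact: mul_conjC_ge0.
  by rewrite lecR; case: (a1 k) (a2 k) a2k a12k => [c1|] [c2|].
- rewrite jk2 andbT; apply: leq_trans ij; rewrite leq_add2l.
  have -> : k2 = (n - #|[pred k | a2 k == None]|)%N.
    by rewrite -mxrank_penalty_domain// -PV2.1 (eqP (diagonalizes_free D2)).
  rewrite rank_ortho (mxrank_rows_in constrained Lfree).
  have : (#|constrained| <= #|[pred k | a2 k == None]| + #|unordered|)%N.
    by rewrite -[leqRHS]cardUI leq_addr.
  rewrite /unordered; lia.
Qed.

End PenalizedForms.

(** * The difference equation *)

Section Equation.
Variables (R : realType) (N : nat) (f q w : nat -> R).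
Local Notation C := R[i].
Implicit Type y : 'rV[C]_N.+2.

Lemma res_mapE AB lam y i : res_map f q w AB lam y 0 i =
  if (i < N)%N then eq_res f q w lam y i.+1
  else (AB *m bvec f y) (inord (i - N)) 0.
Proof. by rewrite mxE. Qed.

Lemma res_map_is_linear AB lam : linear (@res_map R N f q w AB lam).
Proof.
move=> a y y'.
have yvD k : yv (a *: y + y') k = a * yv y k + yv y' k by rewrite /yv !mxE.
have bvecD : bvec f (a *: y + y') = a *: bvec f y + bvec f y'.
  by apply/colP => -[[|[|[|[|//]]]] ?]; rewrite !mxE /= /dlt ?yvD; ring.
apply/rowP => i; rewrite [RHS]mxE [X in _ = X + _]mxE !res_mapE.
case: ifP => _; first by rewrite /eq_res /dlt !yvD; ring.
by rewrite bvecD mulmxDr -scalemxAr [LHS]mxE [X in X + _ = _]mxE.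
Qed.

HB.instance Definition _ AB lam :=
  GRing.isLinear.Build C 'rV[C]_N.+2 'rV[C]_N.+2 _
    (@res_map R N f q w AB lam) (res_map_is_linear AB lam).

Lemma sub_sol_space AB lam y :
  (y <= sol_space N f q w AB lam)%MS <->
  (forall i, (i < N)%N -> eq_res f q w lam y i.+1 = 0) /\ AB *m bvec f y = 0.
Proof.
split=> [/sub_kermxP|[y_eq y_bc]].
  rewrite mul_rV_lin1 /= => /rowP y0; split=> [i iN|].
    have iN2 : (i < N.+2)%N by lia.
    by have := y0 (Ordinal iN2); rewrite res_mapE /= iN mxE.
  apply/colP => j.
  have jN2 : (N + j < N.+2)%N by have := ltn_ord j; lia.
  have := y0 (Ordinal jN2); rewrite res_mapE /= ltnNge leq_addr /= addKn.
  by rewrite inord_val => ->; rewrite !mxE.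
apply/sub_kermxP; rewrite mul_rV_lin1 /=; apply/rowP => i.
by rewrite res_mapE [RHS]mxE; case: ifP => [/y_eq//|_]; rewrite y_bc mxE.
Qed.

Definition flux y k : C := (f k)%:C * dlt y k.

Definition interior y : 'rV[C]_N := \row_i yv y i.+1.

Definition interiormx : 'M[C]_(N.+2, N) :=
  colsub (fun i : 'I_N => inord i.+1) 1%:M.

Lemma mul_interiormx y : y *m interiormx = interior y.
Proof. by rewrite mulmx_colsub mulmx1; apply/rowP=> i; rewrite !mxE. Qed.

Definition offdiag : 'M[C]_N := \matrix_(i, j) ((f j)%:C *+ (j == i.+1 :> nat)).

(* Coordinate i stands for y_(i+1). The terms f_0 and f_N are left out: they
   enter through the boundary fluxes f_0 (Delta y)_0 and f_N (Delta y)_N. *)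
Definition jacobi : 'M[C]_N :=
  (\row_i (q i.+1 + f i *+ (0 < i)%N + f i.+1 *+ (i.+1 < N)%N))%:diagC
  - offdiag - offdiag^T.

Lemma jacobi_herm : jacobi \is hermsymmx.
Proof.
have conj_real (x : R) : Num.conj (x%:C : C) = x%:C by exact: conjc_real.
apply/hermsymmxP/matrixP => i j; rewrite !mxE !rmorphB !rmorphMn /= !conj_real.
by have [->|//] := eqVneq i j; rewrite addrAC.
Qed.

Definition weightmx : 'M[C]_N := (\row_i w i.+1)%:diagC.

Lemma interior_offdiag y (i : 'I_N) :
  (interior y *m offdiag) 0 i = (f i)%:C * yv y i *+ (0 < i)%N.
Proof.
pose F j : C := yv y j.+1 * (f i)%:C.
transitivity (\sum_(j < N | (0 < i)%N && (j == i.-1 :> nat)) F j).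
  rewrite mxE [RHS]big_mkcond; apply: eq_bigr => j _.
  rewrite !mxE mulrnAr mulrb.
  by congr (if _ then _ else _); case: (i : nat) => // k; rewrite eq_sym.
case: (posnP i) => [->|i_gt0]; first by rewrite big_pred0.
rewrite /= big_ord1_eq /F ifT; last by have := ltn_ord i; lia.
by rewrite prednK// mulrC.
Qed.

Lemma interior_offdiagT y (i : 'I_N) :
  (interior y *m offdiag^T) 0 i = (f i.+1)%:C * yv y i.+2 *+ (i.+1 < N)%N.
Proof.
pose F j : C := yv y j.+1 * (f j)%:C.
transitivity (\sum_(j < N | j == i.+1 :> nat) F j).
  rewrite mxE [RHS]big_mkcond; apply: eq_bigr => j _.
  by rewrite !mxE mulrnAr mulrb.
by rewrite big_ord1_eq /F mulrC mulrb.
Qed.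

Lemma eq_res_interior lam y (i : 'I_N) :
  eq_res f q w lam y i.+1 = (interior y *m (jacobi - lam *: weightmx)) 0 i
    + flux y 0 *+ (i == 0 :> nat) - flux y N *+ (i.+1 == N).
Proof.
have -> : flux y 0 *+ (i == 0 :> nat) = flux y i *+ (i == 0 :> nat).
  by case: eqP => [->|].
have -> : flux y N *+ (i.+1 == N) = flux y i.+1 *+ (i.+1 == N).
  by case: eqP => [->|].
rewrite /jacobi !mulmxBr -scalemxAr !mul_mx_diag.
have offd := interior_offdiag y i; have offdT := interior_offdiagT y i.
move: (interior y *m _) (interior y *m _) offd offdT => A B offd offdT.
have iN_lt : (i.+1 < N)%N = (i.+1 != N) by rewrite ltn_neqAle ltn_ord andbT.
rewrite !mxE {}offd {}offdT /eq_res /flux /dlt iN_lt lt0n !rmorphD !rmorphMn /=.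
case: (i == 0 :> nat); case: (i.+1 == N) => /=; rewrite ?mulr1n ?mulr0n; ring.
Qed.

End Equation.

Section InteriorFlux.
Variables (R : realType) (N : nat) (f : nat -> R).
Hypotheses (f0_neq0 : f 0 != 0) (fN_neq0 : f N.+1 != 0).
Local Notation C := R[i].

Lemma interior_flux_eq0 (y : 'rV[C]_N.+3) :
  interior y = 0 -> flux f y 0 = 0 -> flux f y N.+1 = 0 -> y = 0.
Proof.
move=> /rowP int0 flux0 fluxN.
have yv0 j : (0 < j <= N.+1)%N -> yv y j = 0.
  move=> /andP[j_gt0 jN]; have j_lt : (j.-1 < N.+1)%N by lia.
  by have := int0 (Ordinal j_lt); rewrite !mxE /= prednK.
have fC k : f k != 0 -> (f k)%:C != 0 :> C by rewrite fmorph_eq0.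
move/eqP: flux0; rewrite mulf_eq0 (negPf (fC 0%N _))//= /dlt yv0// sub0r.
rewrite oppr_eq0 => /eqP y0.
move/eqP: fluxN; rewrite mulf_eq0 (negPf (fC N.+1 _))//= /dlt.
rewrite (yv0 N.+1) ?leqnn// subr0 => /eqP yN.
apply/rowP => i; rewrite mxE -(inord_val i).
have [->//|i_neq0] := eqVneq (i : nat) 0%N.
have [->//|i_neqN] := eqVneq (i : nat) N.+2.
by apply: yv0; have := ltn_ord i; lia.
Qed.

Lemma exists_interior_flux (x : 'rV[C]_N.+1) (u v : C) :
  exists y, [/\ interior y = x, flux f y 0 = u & flux f y N.+1 = v].
Proof.
pose y : 'rV[C]_N.+3 := \row_k
  (if k == 0 :> nat then x 0 ord0 - (f 0)^-1%:C * u
   else if k == N.+2 :> nat then x 0 ord_max + (f N.+1)^-1%:C * v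
   else x 0 (inord k.-1)).
have int_y : interior y = x.
  apply/rowP => i; have iN : (i.+1 < N.+3)%N by have := ltn_ord i; lia.
  by rewrite mxE /yv mxE inordK//= eqSS ltn_eqF ?ltn_ord// inord_val.
have y1 : yv y 1 = x 0 ord0 by rewrite -int_y mxE.
have yN : yv y N.+1 = x 0 ord_max by rewrite -int_y mxE.
have divfK k t : f k != 0 -> (f k)%:C * ((f k)^-1%:C * t) = t.
  by move=> fk; rewrite mulrA -rmorphM mulfV// mul1r.
exists y; split=> //.
  by rewrite /flux /dlt y1 /yv mxE inordK//= subKr divfK.
by rewrite /flux /dlt yN /yv mxE inordK//= eqxx addrC addKr divfK.
Qed.

End InteriorFlux.

(** * Boundary conditions as penalties *)

Section BoundaryCondition.
Variables (R : realType) (f : nat -> R) (z : R[i]).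
Local Notation C := R[i].

Definition boundary_data (y0 u yN v : C) : 'cV[C]_4 :=
  \col_(j < 4) nth 0 [:: y0; u; yN; v] j.

(* Since u stands for f_0 (Delta y)_0, y0 + u / f 0 is y_1. The dual variables
   come from expressing the boundary terms of the equation in the two elementary
   forms: u e_1 - v e_N = u (e_1 + z e_N) + (- z u - v) e_N. *)
Definition realizes (AB : 'M[C]_(2, 4)) (alpha beta : option R) : Prop :=
  forall y0 u yN v : C,
    AB *m boundary_data y0 u yN v = 0 <->
    penalty_rel alpha (y0 + (f 0)^-1%:C * u + z^* * yN) u /\
    penalty_rel beta yN (- (z * u) - v).

Lemma mul_boundary_data_eq0 (r s : seq C) y0 u yN v :
  (\matrix_(i < 2, j < 4) nth 0 (nth [::] [:: r; s] i) j)
    *m boundary_data y0 u yN v = 0 <->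
  r`_0 * y0 + r`_1 * u + r`_2 * yN + r`_3 * v = 0 /\
  s`_0 * y0 + s`_1 * u + s`_2 * yN + s`_3 * v = 0.
Proof.
set AB := matrix_of_fun _ _.
have rowE i : (AB *m boundary_data y0 u yN v) i 0 =
    let t := nth [::] [:: r; s] i in
    t`_0 * y0 + t`_1 * u + t`_2 * yN + t`_3 * v.
  by rewrite mxE !big_ord_recl big_ord0 !mxE /= addr0 !addrA.
split=> [AB0|[r0 s0]].
  by have := rowE ord0; have := rowE ord_max; rewrite AB0 !mxE /= => <- <-.
by apply/colP => -[[|[|//]] i2]; rewrite rowE mxE.
Qed.

Lemma bcA_realizes a b :
  realizes (bcA z a b) (inv_penalty (1 / f 0 - a)) (Some b).
Proof.
move=> y0 u yN v; apply: iff_trans (mul_boundary_data_eq0 _ _ _ _ _ _) _.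
apply: iff_trans _ (and_iff_compat_r _ (iff_sym (inv_penalty_rel _ _ _))).
rewrite /= !mul0r !mul1r addr0 add0r rmorphB /=.
have -> : y0 + a%:C * u + z^* * yN =
    (y0 + (f 0)^-1%:C * u + z^* * yN) - ((f 0)^-1%:C - a%:C) * u by ring.
have -> : z * u + b%:C * yN + v = b%:C * yN - (- (z * u) - v) by ring.
split=> -[bc0 bcN]; split.
- exact: subr0_eq.
- exact/esym/subr0_eq.
- by rewrite bc0 subrr.
- by rewrite bcN subrr.
Qed.

Lemma bcS1_realizes b : realizes (bcS1 b) (Some 0) (Some b).
Proof.
move=> y0 u yN v; apply: iff_trans (mul_boundary_data_eq0 _ _ _ _ _ _) _.
rewrite /= !mul0r !mul1r !addr0 !add0r.
split=> -[-> ]; rewrite mulr0 oppr0 sub0r => bcN; split=> //.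
  by apply/esym/eqP; rewrite -addr_eq0 bcN.
by rewrite -bcN addNr.
Qed.

Lemma bcS2_realizes a : realizes (bcS2 a) (inv_penalty (1 / f 0 - a)) None.
Proof.
move=> y0 u yN v; apply: iff_trans (mul_boundary_data_eq0 _ _ _ _ _ _) _.
apply: iff_trans _ (and_iff_compat_r _ (iff_sym (inv_penalty_rel _ _ _))).
rewrite /= !mul0r !mul1r !addr0 !add0r rmorphB /=.
have -> : y0 + a%:C * u =
    (y0 + (f 0)^-1%:C * u) - ((f 0)^-1%:C - a%:C) * u by ring.
split=> -[bc0 yN0]; split=> //; move: bc0; rewrite yN0 mulr0 addr0.
  exact: subr0_eq.
by move=> ->; rewrite subrr.
Qed.

End BoundaryCondition.

Section EigenvalueLists.
Variables (R : realType) (N : nat) (f q w : nat -> R).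

Lemma eig_list_unique AB s1 s2 :
  eig_list N f q w AB s1 -> eig_list N f q w AB s2 -> s1 = s2.
Proof.
move=> [s1_sorted mult1] [s2_sorted mult2].
apply: le_sorted_eq => //; apply/allP => x _ /=; apply/eqP.
have := etrans (mult1 x%:C) (esym (mult2 x%:C)).
by rewrite !count_map !(eq_count (fun y => inj_eq (@complexI R) y x)).
Qed.

Lemma has_exactly_size AB k s :
  has_exactly N f q w AB k -> eig_list N f q w AB s -> size s = k.
Proof. by move=> [t [et <-]] es; rewrite (eig_list_unique es et). Qed.

End EigenvalueLists.

Section Reduction.
Variables (R : realType) (M : nat) (f q w : nat -> R) (z : R[i]).
Local Notation C := R[i].
Local Notation n := M.+2.
Hypotheses (f0_neq0 : f 0 != 0) (fN_neq0 : f n != 0).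
Hypothesis w_gt0 : forall k, (1 <= k <= n)%N -> 0 < w k.
Local Notation J := (jacobi n f q).
Local Notation W := (weightmx n w).

Definition boundary_rows : 'M[C]_(2, n) :=
  \matrix_(k < 2) nth 0 [:: 'e_ord0 + z *: 'e_ord_max; 'e_ord_max] k.

Definition boundary_penalty (alpha beta : option R) (k : 'I_2) : option R :=
  nth None [:: alpha; beta] k.

Definition boundary_eigenbasis alpha beta r (P : 'M[C]_(r, n)) d : Prop :=
  penalized_eigenbasis J W boundary_rows (boundary_penalty alpha beta) P d.

Lemma mul_boundary_rows (t : 'rV[C]_2) :
  t *m boundary_rows =
  t 0 ord0 *: 'e_ord0 + (z * t 0 ord0 + t 0 ord_max) *: 'e_ord_max.
Proof.
rewrite mulmx_sum_row !big_ord_recl big_ord0 addr0 !rowK /=.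
rewrite (_ : lift ord0 ord0 = ord_max); last exact: val_inj.
by rewrite scalerDr scalerA -addrA scalerDl [z * _]mulrC.
Qed.

Lemma mul_boundary_trmxC (x : 'rV[C]_n) (k : 'I_2) :
  (x *m boundary_rows^t*) 0 k =
  nth 0 [:: x 0 ord0 + z^* * x 0 ord_max; x 0 ord_max] k.
Proof.
have coordE j : \sum_i x 0 i * (('e_j : 'rV_n) 0 i)^* = x 0 j.
  rewrite (bigD1 j)//= big1 => [|i ij].
    by rewrite mxE !eqxx conjC1 mulr1 addr0.
  by rewrite mxE (negPf ij) conjC0 mulr0.
rewrite mxE -!coordE mulr_sumr -big_split /=.
case: (ord2P k) => -> /=; apply: eq_bigr => i _; rewrite !mxE //=.
by rewrite rmorphD rmorphM mulrDr mulrCA.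
Qed.

Lemma boundary_rows_free : row_free boundary_rows.
Proof.
apply/inj_row_free => v; rewrite mul_boundary_rows => /rowP v0.
have := v0 ord0; rewrite !mxE !eqxx !mulr0 mulr1 addr0 => v00.
have := v0 ord_max; rewrite !mxE !eqxx v00 mul0r mulr0 add0r mulr1 add0r => v01.
by apply/rowP => k; rewrite mxE; case: (ord2P k) => ->.
Qed.

Definition interior_problem alpha beta lam (x : 'rV[C]_n) (u v : C) : Prop :=
  [/\ x *m (J - lam *: W) + u *: 'e_ord0 - v *: 'e_ord_max = 0,
      penalty_rel alpha (x 0 ord0 + z^* * x 0 ord_max) u &
      penalty_rel beta (x 0 ord_max) (- (z * u) - v)].

Lemma sub_sol_space_interior AB alpha beta lam (y : 'rV[C]_n.+2) :
  realizes f z AB alpha beta ->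
  (y <= sol_space n f q w AB lam)%MS <->
  interior_problem alpha beta lam (interior y) (flux f y 0) (flux f y n).
Proof.
move=> AB_bc; apply: iff_trans (sub_sol_space _ _ _ _ _ _) _.
apply: iff_trans (and_iff_compat_l _ (AB_bc _ _ _ _)) _.
have -> : yv y 0 + (f 0)^-1%:C * flux f y 0 = interior y 0 ord0.
  by rewrite mulrA -rmorphM mulVf// mul1r mxE addrC subrK.
have -> : yv y n = interior y 0 ord_max by rewrite mxE.
have residualE (i : 'I_n) : eq_res f q w lam y i.+1 =
    (interior y *m (J - lam *: W)
     + flux f y 0 *: 'e_ord0 - flux f y n *: 'e_ord_max) 0 i.
  rewrite eq_res_interior; move: (interior y *m _) => A.
  by rewrite !mxE !mulr_natr.
split=> [[eq_y [bc0 bcN]]|[eq_x bc0 bcN]]; split=> //.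
  by apply/rowP => i; rewrite -residualE eq_y ?mxE.
by move=> i iN; rewrite (residualE (Ordinal iN)) eq_x mxE.
Qed.

Lemma sub_eigenrows_interior alpha beta r (P : 'M[C]_(r, n)) d lam (x : 'rV_n) :
  boundary_eigenbasis alpha beta P d ->
  (x <= rows_in [pred i | (d 0 i)%:C == lam] P)%MS <->
  exists u v, interior_problem alpha beta lam x u v.
Proof.
move=> Pbasis; apply: iff_trans (sub_penalized_eigenrows lam x Pbasis) _.
split=> [[t xt tP]|[u [v [xuv bc0 bcN]]]].
  exists (t 0 ord0), (- (z * t 0 ord0 + t 0 ord_max)); split.
  - by rewrite scaleNr opprK -addrA -mul_boundary_rows.
  - by have := tP ord0; rewrite mul_boundary_trmxC.
  - by have := tP ord_max; rewrite mul_boundary_trmxC opprK addKr.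
exists (\row_k nth 0 [:: u; - (z * u) - v] k) => [|k]; last first.
  by rewrite mul_boundary_trmxC mxE; case: (ord2P k) => ->.
by rewrite mul_boundary_rows !mxE /= (addrA (z * u)) subrr sub0r scaleNr addrA.
Qed.

Lemma interior_problem0 alpha beta lam u v :
  interior_problem alpha beta lam 0 u v -> u = 0 /\ v = 0.
Proof.
case; rewrite mul0mx add0r => /rowP uv _ _; split.
  by have := uv ord0; rewrite !mxE !eqxx mulr1 mulr0 subr0.
have /eqP := uv ord_max; rewrite !mxE !eqxx mulr1 mulr0 sub0r oppr_eq0.
by move/eqP.
Qed.

Lemma mult_eq_card AB alpha beta r (P : 'M[C]_(r, n)) d lam :
  realizes f z AB alpha beta -> boundary_eigenbasis alpha beta P d ->
  mult n f q w AB lam = #|[pred i | (d 0 i)%:C == lam]|.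
Proof.
move=> AB_bc Pbasis; rewrite -(mxrank_rows_in _ (diagonalizes_free Pbasis.1)).
have solP y := sub_sol_space_interior lam y AB_bc.
have eigP x := sub_eigenrows_interior lam x Pbasis.
rewrite /mult -(mxrank_mul_ker _ (interiormx R n)).
have -> : (sol_space n f q w AB lam :&: kermx (interiormx R n))%MS = 0.
  apply/eqP/rowV0P => y; rewrite sub_capmx => /andP[/solP + /sub_kermxP].
  rewrite mul_interiormx => + int_y; rewrite int_y => /interior_problem0[flux0].
  exact: interior_flux_eq0.
rewrite mxrank0 addn0; apply/eqmx_rank/andP; split; apply/rV_subP => x.
  move=> /submxP[a ->]; rewrite mulmxA mul_interiormx; apply/eigP.
  by do 2!eexists; apply/solP; apply: submxMl.
move=> /eigP[u [v]].
have [y [<- <- <-]] := exists_interior_flux f0_neq0 fN_neq0 x u v.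
by move=> /solP y_sol; rewrite -mul_interiormx submxMr.
Qed.

Lemma exists_boundary_spectrum AB alpha beta :
  realizes f z AB alpha beta ->
  exists r (P : 'M[C]_(r, n)) d,
    boundary_eigenbasis alpha beta P d /\ eig_list n f q w AB (spectrum d).
Proof.
move=> AB_bc; set pen := boundary_penalty alpha beta.
have W_pos : posdefmx W.
  by apply: posdefmx_diag => i; rewrite !mxE ltcR w_gt0//= ltn_ord.
have [P [d Pbasis]] := exists_diagonalizes (penalty_domain boundary_rows pen)
  W_pos (penalized_herm boundary_rows pen (jacobi_herm n f q)).
exists (\rank (penalty_domain boundary_rows pen)), P, d; split=> //.
split=> [|lam]; first exact: sorted_spectrum.
by rewrite (mult_eq_card lam AB_bc Pbasis) count_map count_spectrum.
Qed.

Lemma has_exactly_realizes AB alpha beta : realizes f z AB alpha beta ->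
  has_exactly n f q w AB (n - ((alpha == None) + (beta == None))).
Proof.
move=> /exists_boundary_spectrum[r [P [d [[PD PV] eigs]]]].
exists (spectrum d); split=> //; rewrite size_spectrum.
rewrite -(eqP (diagonalizes_free PD)) PV.1.
by rewrite (mxrank_penalty_domain _ boundary_rows_free) card_ord2.
Qed.

Lemma eig_list_le AB1 AB2 alpha1 alpha2 beta1 beta2 s1 s2 i j :
  realizes f z AB1 alpha1 beta1 -> realizes f z AB2 alpha2 beta2 ->
  eig_list n f q w AB1 s1 -> eig_list n f q w AB2 s2 ->
  (i + (~~ penalty_le alpha1 alpha2 + ~~ penalty_le beta1 beta2) <= j)%N ->
  (j < size s2)%N -> nth 0 s1 i <= nth 0 s2 j.
Proof.
move=> bc1 bc2 eigs1 eigs2 ij js2.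
have [r1 [P1 [d1 [basis1 eigd1]]]] := exists_boundary_spectrum bc1.
have [r2 [P2 [d2 [basis2 eigd2]]]] := exists_boundary_spectrum bc2.
rewrite (eig_list_unique eigs1 eigd1) (eig_list_unique eigs2 eigd2) in js2 *.
apply: (penalized_spectrum_le boundary_rows_free basis1 basis2).
rewrite -(size_spectrum d2) js2 andbT; apply: leq_trans ij.
by rewrite leq_add2l card_ord2.
Qed.

End Reduction.

(** * Comparison of eigenvalues *)

Section EigenvalueInequalities.
Variables (R : realType) (M : nat) (f q w : nat -> R) (z : R[i]).
Local Notation n := M.+2.
Hypotheses (f0_neq0 : f 0 != 0) (fN_neq0 : f n != 0).
Hypothesis w_gt0 : forall k, (1 <= k <= n)%N -> 0 < w k.
Local Notation eigs := (eig_list n f q w).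

Lemma has_exactly_bcA a b :
  has_exactly n f q w (bcA z a b) (if a == 1 / f 0 then n.-1 else n).
Proof.
have := has_exactly_realizes q f0_neq0 fN_neq0 w_gt0 (bcA_realizes f z a b).
by rewrite inv_penalty_eqNone subr_eq0 eq_sym; case: eqP.
Qed.

Lemma has_exactly_bcS1 b : has_exactly n f q w (bcS1 b) n.
Proof.
exact: (has_exactly_realizes q f0_neq0 fN_neq0 w_gt0 (bcS1_realizes f 0 b)).
Qed.

Lemma has_exactly_bcS2 a :
  has_exactly n f q w (bcS2 a) (if a == 1 / f 0 then n.-2 else n.-1).
Proof.
have := has_exactly_realizes q f0_neq0 fN_neq0 w_gt0 (bcS2_realizes f 0 a).
by rewrite inv_penalty_eqNone subr_eq0 eq_sym; case: eqP; rewrite ?subn2.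
Qed.

Lemma size_eig_bcA a b s :
  eigs (bcA z a b) s -> size s = if a == 1 / f 0 then n.-1 else n.
Proof. exact: has_exactly_size (has_exactly_bcA a b). Qed.

Lemma size_eig_bcS1 b s : eigs (bcS1 b) s -> size s = n.
Proof. exact: has_exactly_size (has_exactly_bcS1 b). Qed.

Lemma size_eig_bcS2 a s :
  eigs (bcS2 a) s -> size s = if a == 1 / f 0 then n.-2 else n.-1.
Proof. exact: has_exactly_size (has_exactly_bcS2 a). Qed.

Lemma eig_bcA_le_a12 a a' b s s' i :
  a <= a' -> a' <= 1 / f 0 \/ 1 / f 0 < a ->
  eigs (bcA z a b) s -> eigs (bcA z a' b) s' ->
  (i < if a' == 1 / f 0 then n.-1 else n)%N -> nth 0 s i <= nth 0 s' i.
Proof.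
move=> aa' same_side es es'; rewrite -(size_eig_bcA es').
apply: (eig_list_le f0_neq0 fN_neq0 w_gt0
  (bcA_realizes f z a b) (bcA_realizes f z a' b) es es').
rewrite inv_penalty_le ?penalty_le_refl ?addn0 ?lerD2l ?lerN2//.
by rewrite subr_lt0 subr_ge0 orbC; apply/orP.
Qed.

Lemma eig_bcA_le_a12_succ a a' b s s' i :
  eigs (bcA z a b) s -> eigs (bcA z a' b) s' ->
  (i.+1 < if a' == 1 / f 0 then n.-1 else n)%N -> nth 0 s i <= nth 0 s' i.+1.
Proof.
move=> es es'; rewrite -(size_eig_bcA es').
apply: (eig_list_le f0_neq0 fN_neq0 w_gt0
  (bcA_realizes f z a b) (bcA_realizes f z a' b) es es').
by rewrite penalty_le_refl addn0 -addn1 leq_add2l leq_b1.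
Qed.

Lemma eig_bcA_le_bcS1 a b s s' i :
  1 / f 0 < a -> eigs (bcA z a b) s -> eigs (bcS1 b) s' ->
  (i < n)%N -> nth 0 s i <= nth 0 s' i.
Proof.
move=> fa es es'; rewrite -(size_eig_bcS1 es').
apply: (eig_list_le f0_neq0 fN_neq0 w_gt0
  (bcA_realizes f z a b) (bcS1_realizes f z b) es es').
by rewrite inv_penalty_le0 subr_lt0 fa penalty_le_refl addn0.
Qed.

Lemma eig_bcS1_le_bcA a b s s' i :
  a <= 1 / f 0 -> eigs (bcS1 b) s -> eigs (bcA z a b) s' ->
  (i < if a == 1 / f 0 then n.-1 else n)%N -> nth 0 s i <= nth 0 s' i.
Proof.
move=> af es es'; rewrite -(size_eig_bcA es').
apply: (eig_list_le f0_neq0 fN_neq0 w_gt0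
  (bcS1_realizes f z b) (bcA_realizes f z a b) es es').
by rewrite inv_penalty_ge0 subr_ge0 af penalty_le_refl addn0.
Qed.

Lemma eig_bcA_le_b21 a b b' s s' i :
  b <= b' -> eigs (bcA z a b) s -> eigs (bcA z a b') s' ->
  (i < if a == 1 / f 0 then n.-1 else n)%N -> nth 0 s i <= nth 0 s' i.
Proof.
move=> bb' es es'; rewrite -(size_eig_bcA es').
apply: (eig_list_le f0_neq0 fN_neq0 w_gt0
  (bcA_realizes f z a b) (bcA_realizes f z a b') es es').
by rewrite penalty_le_refl /= bb' addn0.
Qed.

Lemma eig_bcA_le_bcS2 a b s s' i :
  eigs (bcA z a b) s -> eigs (bcS2 a) s' ->
  (i < if a == 1 / f 0 then n.-2 else n.-1)%N -> nth 0 s i <= nth 0 s' i.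
Proof.
move=> es es'; rewrite -(size_eig_bcS2 es').
apply: (eig_list_le f0_neq0 fN_neq0 w_gt0
  (bcA_realizes f z a b) (bcS2_realizes f z a) es es').
by rewrite penalty_le_refl addn0.
Qed.

Lemma eig_bcS2_le_bcA_succ a b s s' i :
  eigs (bcS2 a) s -> eigs (bcA z a b) s' ->
  (i.+1 < if a == 1 / f 0 then n.-1 else n)%N -> nth 0 s i <= nth 0 s' i.+1.
Proof.
move=> es es'; rewrite -(size_eig_bcA es').
apply: (eig_list_le f0_neq0 fN_neq0 w_gt0
  (bcS2_realizes f z a) (bcA_realizes f z a b) es es').
by rewrite penalty_le_refl addn1.
Qed.

End EigenvalueInequalities.

Theorem theorem3p2 (R : realType) (N : nat) (f q w : nat -> R) (z : R[i]) :
  (2 <= N)%N ->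
  (forall n, (n <= N)%N -> f n != 0) ->
  (forall n, (1 <= n <= N)%N -> 0 < w n) ->
  (* eigenvalue counts *)
  (forall a12 b21 : R,
     has_exactly N f q w (bcA z a12 b21)
       (if a12 == 1 / f 0 then N.-1 else N)) /\
  (forall b21 : R, has_exactly N f q w (bcS1 b21) N) /\
  (forall a12 : R,
     has_exactly N f q w (bcS2 a12)
       (if a12 == 1 / f 0 then N.-2 else N.-1)) /\
  (* (i) *)
  (forall (b21 a1 a2 a3 a4 : R) (s1 s2 s3 s4 sS : seq R),
     a1 < a2 -> a2 <= 1 / f 0 -> 1 / f 0 < a3 -> a3 < a4 ->
     eig_list N f q w (bcA z a1 b21) s1 ->
     eig_list N f q w (bcA z a2 b21) s2 ->
     eig_list N f q w (bcA z a3 b21) s3 ->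
     eig_list N f q w (bcA z a4 b21) s4 ->
     eig_list N f q w (bcS1 b21) sS ->
     (forall n, (n.+2 <= N)%N ->
        nth 0 s3 n <= nth 0 s4 n /\ nth 0 s4 n <= nth 0 sS n /\
        nth 0 sS n <= nth 0 s1 n /\ nth 0 s1 n <= nth 0 s2 n /\
        nth 0 s2 n <= nth 0 s3 n.+1) /\
     (nth 0 s3 N.-1 <= nth 0 s4 N.-1 /\ nth 0 s4 N.-1 <= nth 0 sS N.-1 /\
      nth 0 sS N.-1 <= nth 0 s1 N.-1) /\
     (a2 < 1 / f 0 -> nth 0 s1 N.-1 <= nth 0 s2 N.-1)) /\
  (* (ii) *)
  (forall (a12 b1 b2 : R) (s1 s2 sS : seq R),
     b1 < b2 ->
     eig_list N f q w (bcA z a12 b1) s1 ->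
     eig_list N f q w (bcA z a12 b2) s2 ->
     eig_list N f q w (bcS2 a12) sS ->
     (forall n, (n.+3 <= N)%N ->
        nth 0 s1 n <= nth 0 s2 n /\ nth 0 s2 n <= nth 0 sS n /\
        nth 0 sS n <= nth 0 s1 n.+1) /\
     nth 0 s1 (N.-2) <= nth 0 s2 (N.-2) /\
     (a12 != 1 / f 0 ->
        nth 0 s2 (N.-2) <= nth 0 sS (N.-2) /\
        nth 0 sS (N.-2) <= nth 0 s1 N.-1 /\
        nth 0 s1 N.-1 <= nth 0 s2 N.-1)).
Proof.
case: N => [//|[//|M]] _ f_neq0 w0.
have [f0 fN] := (f_neq0 0%N isT, f_neq0 M.+2 (leqnn _)).
do 4?split.
- exact: has_exactly_bcA.
- exact: has_exactly_bcS1.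
- exact: has_exactly_bcS2.
- move=> b a1 a2 a3 a4 s1 s2 s3 s4 sS a12 a2f fa3 a34 e1 e2 e3 e4 eS.
  have [a1f fa4] := (lt_le_trans a12 a2f, lt_trans fa3 a34).
  have le34 := eig_bcA_le_a12 f0 fN w0 (ltW a34) (or_intror fa3) e3 e4.
  have le4S := eig_bcA_le_bcS1 f0 fN w0 fa4 e4 eS.
  have leS1 := eig_bcS1_le_bcA f0 fN w0 (ltW a1f) eS e1.
  have le12 := eig_bcA_le_a12 f0 fN w0 (ltW a12) (or_introl a2f) e1 e2.
  have le23 := eig_bcA_le_a12_succ f0 fN w0 e2 e3.
  rewrite (gt_eqF fa4) in le34; rewrite (lt_eqF a1f) in leS1.
  rewrite (gt_eqF fa3) in le23; split=> [i iM|].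
    by rewrite le34 ?le4S ?leS1 ?le12 ?le23//; try case: ifP => _; lia.
  rewrite le34 ?le4S ?leS1//; split=> // a2f_lt.
  by rewrite le12// lt_eqF.
- move=> a b1 b2 s1 s2 sS b12 e1 e2 eS.
  have le12 := eig_bcA_le_b21 f0 fN w0 (ltW b12) e1 e2.
  have le2S := eig_bcA_le_bcS2 f0 fN w0 e2 eS.
  have leS1 := eig_bcS2_le_bcA_succ f0 fN w0 eS e1.
  case: (a == 1 / f 0) le12 le2S leS1 => le12 le2S leS1.
  all: split=> [i iM|]; last split=> [|//].
  all: by rewrite ?le12 ?le2S ?leS1//; lia.
Qed.
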